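(* Let $n\ge1$, suppose $\lambda\ge\frac{n+2}{n}$ and $\gamma=\frac{n+2-\varepsilon}{2\lambda}$ for some $\varepsilon\in(0,1)$. Then the function $$u(x,t)=\Psi(x,t):=\int_{\mathbb{R}^n}\Phi(x-y,t)|y|^{-2\gamma}\,dy$$ is a $C^\infty$ positive solution of $u_t-\Delta u=0$ in $\mathbb{R}^n\times(0,\infty)$ such that $u\in L^\lambda(\mathbb{R}^n\times(0,T))$ for all $T>0$, $t^\gamma u(0,t)=u(0,1)$ for all $t>0$, and $t^\gamma u(x,t)$ is bounded between positive constants on the set $\{(x,t)\in\mathbb{R}^n\times(0,\infty):|x|<\sqrt t\}$.
   Context: $\Phi$ is the heat kernel: $\Phi(x,t)=(4\pi t)^{-n/2}e^{-|x|^2/(4t)}$ for $t>0$ and $\Phi(x,t)=0$ for $t\le0$. *)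

(* Defs.v *)
From HB Require Import structures.
From mathcomp Require Import all_boot all_order all_algebra.
From mathcomp Require Import all_classical all_reals all_analysis.
Set Implicit Arguments. Unset Strict Implicit. Unset Printing Implicit Defensive.
Import Order.TTheory GRing.Theory Num.Theory.
Import numFieldNormedType.Exports.
Local Open Scope classical_set_scope.
Local Open Scope ring_scope.

(* Euclidean norm |x| (the library norm on 'rV is the max norm). *)
Definition enorm (R : realType) (n : nat) (x : 'rV[R]_n) : R :=
  Num.sqrt (\sum_(i < n) x ord0 i ^+ 2).

Definition heat_kernel (R : realType) (n : nat) (x : 'rV[R]_n) (t : R) : R :=
  if 0 < t then
    powR (4 * pi * t) (- (n%:R / 2)) * expR (- (enorm x ^+ 2) / (4 * t))
  else 0.

(* Iterated Lebesgue integral over R^k of f : (nat -> R) -> \bar R,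
   integrating coordinates k-1, ..., 0 (outermost first). *)
Fixpoint iter_int (R : realType) (k : nat) (f : (nat -> R) -> \bar R) : \bar R :=
  match k with
  | 0 => f (fun _ => 0)
  | k'.+1 => (\int[@lebesgue_measure R]_(s in [set: R])
               iter_int k' (fun c => f (fun j => if j == k' then s else c j)))%E
  end.

(* Integral over R^n of a NONNEGATIVE function F : 'rV[R]_n -> \bar R,
   computed as an iterated integral (equal to the Lebesgue integral on R^n
   for nonnegative measurable F by Tonelli). *)
Definition Rn_int (R : realType) (n : nat) (F : 'rV[R]_n -> \bar R) : \bar R :=
  iter_int n (fun c => F (\row_(i < n) c (nat_of_ord i))).

Definition Psi_ext (R : realType) (n : nat) (gamma : R) (x : 'rV[R]_n) (t : R)
  : \bar R :=
  Rn_int (fun y => (heat_kernel (x - y) t * powR (enorm y) (- (2 * gamma)))%:E).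

Definition Psi (R : realType) (n : nat) (gamma : R) (x : 'rV[R]_n) (t : R) : R :=
  fine (Psi_ext gamma x t).

Fixpoint iterD (R : realType) (V : normedModType R) (vs : seq V) (f : V -> R)
  : V -> R :=
  match vs with
  | [::] => f
  | v :: vs' => 'D_v (iterD vs' f)
  end.

Definition smooth_on (R : realType) (V : normedModType R) (U : set V)
  (f : V -> R) : Prop :=
  forall (vs : seq V) (p : V), U p ->
    {for p, continuous (iterD vs f)} /\ (forall v : V, derivable (iterD vs f) p v).

Definition uncurry_xt (R : realType) (n : nat) (u : 'rV[R]_n -> R -> R)
  : 'rV[R]_n * R -> R := fun p => u p.1 p.2.

Definition dt (R : realType) (n : nat) (u : 'rV[R]_n -> R -> R) (x : 'rV[R]_n) (t : R) : R :=
  'D_((0 : 'rV[R]_n), (1 : R)) (uncurry_xt u) (x, t).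

Definition laplacian (R : realType) (n : nat) (u : 'rV[R]_n -> R -> R)
  (x : 'rV[R]_n) (t : R) : R :=
  \sum_(i < n)
    'D_((delta_mx ord0 i : 'rV[R]_n), (0 : R))
       ('D_((delta_mx ord0 i : 'rV[R]_n), (0 : R)) (uncurry_xt u)) (x, t).

(* Main.v *)
Require Import Defs.
From HB Require Import structures.
From mathcomp Require Import all_boot all_order all_algebra.
From mathcomp Require Import all_classical all_reals all_analysis.
From mathcomp Require Import measurable_realfun ring lra.
Set Implicit Arguments. Unset Strict Implicit. Unset Printing Implicit Defensive.
Import Order.TTheory GRing.Theory Num.Theory.
Import numFieldNormedType.Exports.
Local Open Scope classical_set_scope.
Local Open Scope ring_scope.

(** With r = e^s, the Gamma integral gives
      |y|^(-2g) = (4t)^(-g) / Gamma(g) * int_R exp(g s - e^s |y|^2 / (4t)) ds.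
    By Tonelli the y-integral in Psi becomes a product of one-dimensional
    Gaussian integrals, and
      Psi(x, t) = (4t)^(-g) / Gamma(g) * M_0(|x|^2 / (4t)),
      M_j(z) = int_R L(s)^j w(s) exp(- z L(s)) ds,
    where L(s) = e^s / (1 + e^s) and w(s) = e^(g s) (1 + e^s)^(-n/2).
    Self-similarity and the bounds on |x| < sqrt t are read off this formula.
    Since M_j' = - M_(j+1), the algebra generated by the coordinates x_i and the
    functions t^a M_j(|x|^2 / (4t)) is stable under all directional derivatives,
    so Psi is smooth. The heat equation reduces to the Kummer equation
    z M_2 - (n/2 + z) M_1 + g M_0 = 0, which says that the integral over R of
    the derivative of w exp(- z L) vanishes. Finally M_0(z) <= C (1 + z)^(-g)
    gives Psi <= C' (4t + |x|^2)^(-g), and the same Gamma trick computes the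
    integral over R^n of (4t + |x|^2)^(-p), p = g lam, as a multiple of
    t^(n/2 - p), where p - n/2 = 1 - eps/2 < 1. *)

(** * Kummer integrals *)

Section weight_integrals.
Variable R : realType.
Notation mu := (@lebesgue_measure R).

Lemma integrable_le_scale (f g : R -> R) (K : R) :
  measurable_fun setT f -> (forall x, `|f x| <= K * g x) ->
  mu.-integrable setT (EFin \o g) -> mu.-integrable setT (EFin \o f).
Proof.
move=> mf fg ig.
apply: (@le_integrable _ _ _ mu _ _ _ (fun x => (K%:E * (g x)%:E)%E)) => //.
- exact/measurable_EFinP.
- move=> x _ /=; rewrite lee_fin; apply: le_trans (fg x) _; exact: ler_norm.
- exact: integrableZl.
Qed.

Lemma continuous_expRN_abs (c : R) : continuous (fun s : R => expR (- c * `|s|)).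
Proof.
move=> s; apply: continuous_comp; last exact: continuous_expR.
by apply: cvgM; [exact: cvg_cst|exact: norm_continuous].
Qed.

Lemma integrable_expRN_abs (c : R) : 0 < c ->
  mu.-integrable setT (EFin \o (fun s : R => expR (- c * `|s|))).
Proof.
move=> c0; have cf := @continuous_expRN_abs c.
apply/integrableP; split.
  by apply/measurable_EFinP; exact: continuous_measurable_fun.
under eq_integral do rewrite /= ger0_norm ?expR_ge0//.
rewrite ge0_symfun_integralT//; last by move=> x /=; rewrite normrN.
rewrite -set_itvcy; apply: lte_mul_pinfty => //.
have pge0 x : (0 <= (exponential_pdf c x)%:E)%E.
  by rewrite lee_fin exponential_pdf_ge0// ltW.
have mpdf D : measurable_fun D (EFin \o exponential_pdf c).
  by apply/measurable_EFinP/measurable_funTS; exact: measurable_exponential_pdf.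
apply: (@le_lt_trans _ _ (\int[mu]_(x in `[0%R, +oo[)
   ((c^-1)%:E * (exponential_pdf c x)%:E))%E).
  apply: ge0_le_integral => //=.
  - by apply/measurable_EFinP/measurable_funTS; exact: continuous_measurable_fun.
  - apply/measurable_EFinP/measurable_funTS; apply: measurable_funM => //.
    exact: measurable_exponential_pdf.
  - move=> x; rewrite in_itv/= andbT => x0; rewrite -EFinM lee_fin exponential_pdfE//.
    by rewrite mulrA mulVf ?gt_eqF// mul1r ger0_norm.
rewrite ge0_integralZl//=; last 2 first.
  exact: mpdf.
  by rewrite lee_fin invr_ge0 ltW.
apply: (@le_lt_trans _ _ ((c^-1)%:E * \int[mu]_x (exponential_pdf c x)%:E)%E).
  apply: lee_wpmul2l; first by rewrite lee_fin invr_ge0 ltW.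
  apply: ge0_subset_integral => //=; exact: mpdf.
by rewrite integral_exponential_pdf// mule1 ltry.
Qed.

(** A zero integral would make [f] vanish almost everywhere; as [f] vanishes nowhere, the whole line
    would then be a null set. *)
Lemma Rintegral_gt0 (f : R -> R) : mu.-integrable setT (EFin \o f) ->
  (forall x, 0 < f x) -> 0 < \int[mu]_x f x.
Proof.
move=> fi f0; rewrite lt_neqAle Rintegral_ge0 ?andbT//; last first.
  by move=> x _; exact: ltW.
apply/eqP => Ieq.
have I0 : (\int[mu]_x (f x)%:E = 0)%E.
  rewrite -[LHS]fineK; last exact: (integrable_fin_num measurableT fi).
  by move: Ieq; rewrite /Rintegral => <-.
have : (\int[mu]_x `|(f x)%:E|)%E = 0%E.
  by under eq_integral do rewrite /= ger0_norm ?ltW//.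
case/ (ae_eq_integral_abs mu measurableT _).1.
  by case/integrableP : fi.
move=> N [mN N0]; have -> : ~` [set x | setT x -> (f x)%:E = cst 0 x :> \bar R] = setT.
  apply/seteqP; split => // x _ /= /(_ I) [] e.
  by have := f0 x; rewrite e ltxx.
move=> TN; have : mu (setT : set R) = 0%E.
  by apply/eqP; rewrite -measure_le0 -[leRHS]N0 le_measure ?inE.
by rewrite -set_itvNyy lebesgue_measure_itv.
Qed.

(** * The logistic function, the weight and the integrals M_j *)

Definition logistic (s : R) : R := expR s / (1 + expR s).

Lemma expR1D_gt0 (s : R) : 0 < 1 + expR s.
Proof. by rewrite addr_gt0// expR_gt0. Qed.

Lemma logistic_gt0 s : 0 < logistic s.
Proof. by rewrite divr_gt0 ?expR_gt0 ?expR1D_gt0. Qed.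

Lemma logistic_lt1 s : logistic s < 1.
Proof. by rewrite ltr_pdivrMr ?expR1D_gt0// mul1r ltrDr. Qed.

Lemma is_derive_logistic (s : R) : is_derive s 1 logistic (logistic s * (1 - logistic s)).
Proof.
have e0 : (cst 1 + expR) s != 0 by rewrite gt_eqF ?expR1D_gt0.
have d1 := is_deriveD (is_derive_cst (1 : R) s 1) (is_derive_expR s).
apply: (is_derive_eq (is_deriveM (is_derive_expR s) (is_deriveV e0 d1))).
rewrite /logistic /GRing.scale /= !fctE /=; move: e0; rewrite !fctE /= => e0.
by field.
Qed.

Lemma continuous_logistic : continuous logistic.
Proof.
move=> s; apply: differentiable_continuous; apply/derivable1_diffP.
by case: (is_derive_logistic s).
Qed.

Variables (g k : R).

Definition weight (s : R) : R := expR (g * s) * powR (1 + expR s) (- k).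

Lemma weight_gt0 s : 0 < weight s.
Proof. by rewrite mulr_gt0 ?expR_gt0 ?powR_gt0 ?expR1D_gt0. Qed.

Lemma is_derive_weight (s : R) : is_derive s 1 weight (weight s * (g - k * logistic s)).
Proof.
have d1 := is_deriveD (is_derive_cst (1 : R) s 1) (is_derive_expR s).
have d2 := @is_derive1_comp _ (fun x => powR x (- k)) (cst 1 + expR) s _ _
  (is_derive1_powR (- k) (expR1D_gt0 s)) d1.
have d3 := is_derive1_comp (is_derive_expR (g * s)) (is_deriveZ g (is_derive_id s 1)).
apply: (is_derive_eq (is_deriveM d3 d2)).
have e0 : 1 + expR s != 0 by rewrite gt_eqF ?expR1D_gt0.
rewrite /weight /logistic /GRing.scale /= !fctE /= powRB; last first.
  by apply/implyP => _; rewrite gt_eqF ?expR1D_gt0.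
rewrite powRr1 ?ltW ?expR1D_gt0//.
by field.
Qed.

Lemma continuous_weight : continuous weight.
Proof.
move=> s; apply: differentiable_continuous; apply/derivable1_diffP.
by case: (is_derive_weight s).
Qed.

(** The number ln (1 + e^s) is at least s and at least 0. The first bound gives the rate k - g for s
    >= 0, the second the rate g for s < 0. *)
Lemma weight_le s : 0 <= k -> weight s <= expR (- Num.min g (k - g) * `|s|).
Proof.
move=> k0; rewrite /weight /powR gt_eqF ?expR1D_gt0// -expRD ler_expR.
have [s0|s0] := leP 0 s.
  have h : s <= ln (1 + expR s).
    by rewrite -{1}(expRK s) ler_ln ?posrE ?expR_gt0 ?expR1D_gt0// lerDr.
  have h1 : Num.min g (k - g) * s <= (k - g) * s.
    by rewrite ler_wpM2r// ge_min lexx orbT.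
  have h2 : k * s <= k * ln (1 + expR s) by rewrite ler_wpM2l.
  rewrite ger0_norm//; lra.
have h : 0 <= ln (1 + expR s) by rewrite ln_ge0// lerDl expR_ge0.
have h1 : Num.min g (k - g) * (- s) <= g * (- s).
  by apply: ler_wpM2r; [rewrite oppr_ge0 ltW|rewrite ge_min lexx].
have h2 : 0 <= k * ln (1 + expR s) by rewrite mulr_ge0.
rewrite ltr0_norm//; lra.
Qed.

Hypothesis g0 : 0 < g.
Hypothesis gk : g < k.

Lemma integrable_weight : mu.-integrable setT (EFin \o weight).
Proof.
apply: (@integrable_le_scale _ (fun s => expR (- Num.min g (k - g) * `|s|)) 1).
- exact: continuous_measurable_fun continuous_weight.
- move=> s; rewrite mul1r gtr0_norm ?weight_gt0//.
  by apply: weight_le; rewrite ltW// (lt_trans g0).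
- by apply: integrable_expRN_abs; rewrite lt_min g0 subr_gt0.
Qed.

Definition kummer_fun (j : nat) (z s : R) : R :=
  logistic s ^+ j * (weight s * expR (- z * logistic s)).

(** Substituting q = [logistic s] gives Euler's integral of q^(g+j-1) (1-q)^(k-g-1) exp(-z q) over
    (0, 1), a multiple of the confluent hypergeometric function M(g+j, k+j, -z). *)
Definition kummer (j : nat) (z : R) : R := \int[mu]_s kummer_fun j z s.

Lemma kummer_fun_gt0 j z s : 0 < kummer_fun j z s.
Proof. by rewrite mulr_gt0 ?exprn_gt0 ?mulr_gt0 ?expR_gt0 ?weight_gt0 ?logistic_gt0. Qed.

Lemma continuous_kummer_fun j z : continuous (kummer_fun j z).
Proof.
move=> s; apply: cvgM.
  by apply: (@cvg_comp _ _ _ _ (fun x => x ^+ j)) (@continuous_logistic s) _;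
    exact: exprn_continuous.
apply: cvgM; first exact: continuous_weight.
apply: continuous_comp; last exact: continuous_expR.
by apply: cvgM; [exact: cvg_cst|exact: continuous_logistic].
Qed.

(** Since [logistic] lies between 0 and 1, its powers are at most 1 and the exponential is at most
    e^M. The majorant does not depend on z in [-M, M], as differentiation under the integral
    demands. *)
Lemma kummer_fun_le j z M s : `|z| <= M -> kummer_fun j z s <= expR M * weight s.
Proof.
move=> zM; have s0 := logistic_gt0 s; have s1 := logistic_lt1 s; have w0 := weight_gt0 s.
apply: (@le_trans _ _ (1 * (weight s * expR (- z * logistic s)))).
  rewrite ler_wpM2r ?mulr_ge0 ?expR_ge0 ?(ltW w0)//.
  by rewrite exprn_ile1// ltW.
rewrite mul1r mulrC ler_wpM2r ?(ltW w0)// ler_expR.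
rewrite (le_trans (ler_norm _))// normrM normrN (le_trans _ zM)//.
by rewrite ler_piMr// gtr0_norm// ltW.
Qed.

Lemma integrable_kummer_fun j z : mu.-integrable setT (EFin \o kummer_fun j z).
Proof.
apply: (@integrable_le_scale _ weight (expR `|z|)) integrable_weight.
- exact: continuous_measurable_fun (@continuous_kummer_fun j z).
- by move=> s; rewrite gtr0_norm ?kummer_fun_gt0// kummer_fun_le.
Qed.

Lemma kummer_gt0 j z : 0 < kummer j z.
Proof. exact: Rintegral_gt0 (integrable_kummer_fun j z) (kummer_fun_gt0 j z). Qed.

Lemma kummer_nonincreasing z1 z2 j : z1 <= z2 -> kummer j z2 <= kummer j z1.
Proof.
move=> z12; apply: le_Rintegral => //; do ?exact: integrable_kummer_fun.
move=> s _; rewrite /kummer_fun ler_pM2l ?exprn_gt0 ?logistic_gt0//.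
by rewrite ler_pM2l ?weight_gt0// ler_expR ler_pM2r ?logistic_gt0// lerN2.
Qed.

Lemma is_derive_kummer_fun j (z s : R) : is_derive z 1 (kummer_fun j ^~ s) (- kummer_fun j.+1 z s).
Proof.
have d := is_derive1_comp (is_derive_expR (- logistic s * z))
  (is_deriveZ (- logistic s) (is_derive_id z 1)).
have -> : kummer_fun j ^~ s = (logistic s ^+ j * weight s) *: (expR \o *%R (- logistic s)).
  by apply/funext => x; rewrite /kummer_fun /GRing.scale/= /GRing.scale/= mulrA !mulNr (mulrC x).
apply: (is_derive_eq (is_deriveZ _ d)).
by rewrite /kummer_fun exprS /GRing.scale/= mulr1 !mulNr (mulrC z); ring.
Qed.

(** On the interval from z - 1 to z + 1 one has |x| <= |z| + 1, so [kummer_fun_le] supplies the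
    single majorant [G] of all partial derivatives. *)
Lemma is_derive_kummer j (z : R) : is_derive z 1 (kummer j) (- kummer j.+1 z).
Proof.
have zI : `]z - 1, z + 1[%classic z by rewrite /= in_itv/= !ltrBlDr !ltrDl ltr01.
have h1 x : `]z - 1, z + 1[%classic x -> mu.-integrable setT (EFin \o kummer_fun j x).
  by move=> _; exact: integrable_kummer_fun.
have h2 (x y : R) : `]z - 1, z + 1[%classic x -> setT y -> derivable (kummer_fun j ^~ y) x 1.
  by move=> _ _; case: (is_derive_kummer_fun j x y).
have p1 (x y : R) : partial1of2 (kummer_fun j) x y = - kummer_fun j.+1 x y.
  by rewrite partial1of2E; case: (is_derive_kummer_fun j x y).
pose G := fun y => expR (`|z| + 1) * weight y.
have G0 y : 0 <= G y by rewrite mulr_ge0 ?expR_ge0 ?ltW ?weight_gt0.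
have iG : mu.-integrable setT (EFin \o G).
  by rewrite /comp; under eq_fun do rewrite EFinM; exact: integrableZl integrable_weight.
have hG (x y : R) : `]z - 1, z + 1[%classic x -> setT y -> `|partial1of2 (kummer_fun j) x y| <= G y.
  rewrite /= in_itv/= => /andP[xl xr] _; rewrite p1 normrN gtr0_norm ?kummer_fun_gt0//.
  apply: kummer_fun_le; rewrite ler_norml; apply/andP; split.
    by have := ler_norm (- z); rewrite normrN; lra.
  by have := ler_norm z; lra.
apply: DeriveDef; first exact: derivable_under_integral zI h1 h2 G G0 iG hG.
rewrite -derive1E [LHS](differentiation_under_integral measurableT zI h1 h2 G0 iG hG).
under eq_Rintegral do rewrite p1 -mulN1r.
by rewrite RintegralZl// ?mulN1r//; exact: integrable_kummer_fun.
Qed.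

(** * Vanishing boundary terms and the Kummer equation *)

Lemma integral_derive_eq0 (F f : R -> R) :
  (forall s : R, is_derive s 1 F (f s)) -> continuous f ->
  mu.-integrable setT (EFin \o f) ->
  F n%:R @[n --> \oo] --> 0 -> F (- n%:R) @[n --> \oo] --> 0 ->
  \int[mu]_x f x = 0.
Proof.
move=> dF cf fi Fy FNy.
(* The integrals over [-n, n] tend to that of [f] by dominated convergence; they also equal F(n) -
   F(-n), which tends to 0. *)
pose f_ (n : nat) := (EFin \o f) \_ `[- n%:R, n%:R].
have h1 : (\int[mu]_x f_ n x)%E @[n --> \oo] --> (\int[mu]_x (f x)%:E)%E.
  apply: (@dominated_cvg _ _ _ mu setT measurableT f_ (EFin \o f)
    (fun x => `|(f x)%:E|%E)) => //.
  - move=> n; apply/(measurable_restrictT _ _).1 => //.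
    by apply: measurable_funTS; case/integrableP : fi.
  - move=> x _; apply: cvg_near_cst; near=> n.
    rewrite /f_ patchE ifT// inE/= in_itv/= -ler_norml.
    by near: n; exact: nbhs_infty_ger.
  - exact: integrable_abse.
  - by move=> n x _; rewrite /f_ patchE; case: ifP => //; rewrite abse0 abse_ge0.
have h2 : (\int[mu]_x f_ n x)%E @[n --> \oo] --> (0 : \bar R)%E.
  apply: (@cvg_trans _ (EFin (F n%:R - F (- n%:R)) @[n --> \oo])).
    apply: near_eq_cvg; near=> n.
    (* The fundamental theorem of calculus asks for a nondegenerate interval, which excludes n =
       0. *)
    have n0 : (0 < n)%N by near: n; exact: nbhs_infty_gt.
    rewrite /f_ -integral_mkcond EFinB (@continuous_FTC2 _ f F)//.
    - by rewrite gtrN// ltr0n.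
    - exact: continuous_subspaceT.
    - have cF : continuous F.
        move=> x; apply: differentiable_continuous; apply/derivable1_diffP.
        by case: (dF x).
      split; first by move=> x _; case: (dF x).
      + by apply: cvg_at_right_filter; exact: cF.
      + by apply: cvg_at_left_filter; exact: cF.
    - by move=> x _; rewrite derive1E; case: (dF x).
  apply: cvg_EFin; first exact: nearW.
  by rewrite -[X in _ --> X](subr0 0); exact: cvgB.
by rewrite /Rintegral (cvg_unique _ h1 h2).
Unshelve. all: by end_near. Qed.

Lemma cvg_expRN_nat (c : R) : 0 < c -> expR (- c * n%:R) @[n --> \oo] --> (0 : R).
Proof.
move=> c0; apply/cvgrPdist_lt => e e0; near=> n.
rewrite sub0r normrN ger0_norm ?expR_ge0//.
rewrite -[ltRHS]lnK ?posrE// ltr_expR mulNr ltrNl mulrC -ltr_pdivrMr//.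
by near: n; exact: nbhs_infty_gtr.
Unshelve. all: by end_near. Qed.

(** As L' = L (1 - L) and w' = w (g - k L), the logarithmic derivative is g - k L - z L (1 - L);
    each power of L raises the index by one. *)
Lemma is_derive_kummer_fun0 (z s : R) : is_derive s 1 (kummer_fun 0 z)
  (g * kummer_fun 0 z s - (k + z) * kummer_fun 1 z s + z * kummer_fun 2 z s).
Proof.
have d := @is_derive1_comp _ expR (- z *: logistic) s _ _ (is_derive_expR (- z * logistic s))
  (is_deriveZ (- z) (is_derive_logistic s)).
have e : kummer_fun 0 z = weight * (expR \o (- z *: logistic)).
  by apply/funext => x; rewrite /kummer_fun expr0 mul1r.
rewrite [X in is_derive _ _ X _]e.
apply: (is_derive_eq (is_deriveM (is_derive_weight s) d)).
by rewrite /kummer_fun /GRing.scale/= /GRing.scale/=; ring.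
Qed.

(* The left-hand side is the integral of the derivative in s of [kummer_fun 0 z]. *)
Lemma kummer_ode z : g * kummer 0 z - (k + z) * kummer 1 z + z * kummer 2 z = 0.
Proof.
pose f s := g * kummer_fun 0 z s - (k + z) * kummer_fun 1 z s + z * kummer_fun 2 z s.
have ik (a : R) j : mu.-integrable setT (fun s => (a * kummer_fun j z s)%:E).
  under eq_fun do rewrite EFinM.
  by apply: integrableZl => //; exact: integrable_kummer_fun.
have ik1 : mu.-integrable setT (fun s => (g * kummer_fun 0 z s - (k + z) * kummer_fun 1 z s)%:E).
  by under eq_fun do rewrite EFinB; exact: integrableB.
have fi : mu.-integrable setT (EFin \o f).
  by rewrite /comp /f; under eq_fun do rewrite EFinD; exact: integrableD.
rewrite /kummer -!RintegralZl//; do ?exact: integrable_kummer_fun.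
have <- : \int[mu]_s f s = \int[mu]_s (g * kummer_fun 0 z s) -
    \int[mu]_s ((k + z) * kummer_fun 1 z s) + \int[mu]_s (z * kummer_fun 2 z s).
  rewrite /f (@RintegralD _ _ _ mu setT
    (fun s => g * kummer_fun 0 z s - (k + z) * kummer_fun 1 z s)
    (fun s => z * kummer_fun 2 z s))//; last exact: ik.
  by rewrite (@RintegralB _ _ _ mu setT
    (fun s => g * kummer_fun 0 z s) (fun s => (k + z) * kummer_fun 1 z s))//; exact: ik.
(* One squeeze by exp(|z|) exp(-c n) serves both ends, a n = n and a n = -n. *)
have F0 (a : nat -> R) : (forall n, `|a n| = n%:R) -> kummer_fun 0 z (a n) @[n --> \oo] --> 0.
  move=> an; pose c := Num.min g (k - g).
  have c0 : 0 < c by rewrite lt_min g0 subr_gt0.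
  apply: (@squeeze_cvgr _ _ _ _ (cst 0) (fun n => expR `|z| * expR (- c * n%:R))).
  - apply: nearW => n /=; rewrite (ltW (kummer_fun_gt0 _ _ _))/=.
    rewrite (le_trans (@kummer_fun_le _ _ `|z| _ _))// ler_pM2l ?expR_gt0// -an.
    by apply: weight_le; rewrite ltW// (lt_trans g0).
  - exact: cvg_cst.
  - rewrite -[X in _ --> X](mulr0 (expR `|z|)).
    by apply: cvgM; [exact: cvg_cst|exact: cvg_expRN_nat].
apply: (@integral_derive_eq0 (kummer_fun 0 z)) => //.
- by move=> s; exact: is_derive_kummer_fun0.
- move=> s; apply: cvgD; [apply: cvgB|]; apply: cvgM;
    do ?exact: cvg_cst; exact: continuous_kummer_fun.
- by apply: F0 => n; rewrite ger0_norm.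
- by apply: F0 => n; rewrite normrN ger0_norm.
Qed.

End weight_integrals.

(** * The Gamma integral in the logarithmic variable *)

Section gamma_integral.
Variable R : realType.
Notation mu := (@lebesgue_measure R).

Lemma integral_shift (G : R -> R) (a : R) : continuous G -> (forall x, 0 <= G x) ->
  (\int[mu]_s (G (s + a))%:E = \int[mu]_s (G s)%:E)%E.
Proof.
move=> cG G0; have d (x : R) : is_derive x 1 (shift a) 1 := is_derive_shift x 1 a.
have dE : (shift a)^`()%classic = cst (1 : R).
  by apply/funext => x; rewrite derive1E; case: (d x).
rewrite [RHS](@increasing_ge0_integration_by_substitutionT _ (shift a))//.
- by apply: eq_integral => x _; rewrite dE /= mulr1.
- by move=> x y xy; rewrite /= ltrD2r.
- by rewrite dE; exact: cst_continuous.
- by rewrite dE; exact: is_cvg_cst.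
- by rewrite dE; exact: is_cvg_cst.
- apply/cvgrNyPle => A; near=> x; rewrite /= -lerBrDr.
  by near: x; apply: nbhs_ninfty_le; rewrite num_real.
- apply/cvgryPge => A; near=> x; rewrite /= -lerBlDr.
  by near: x; apply: nbhs_pinfty_ge; rewrite num_real.
Unshelve. all: by end_near. Qed.

(** The Gamma integrand r^p exp(-A r) dr / r in the variable r = e^s; for p > 0, [gamma_int p] is
    Euler's Gamma(p). *)
Definition gamma_fun (p A s : R) : R := expR (p * s - A * expR s).

Definition gamma_int (p : R) : R := \int[mu]_s gamma_fun p 1 s.

Lemma continuous_gamma_fun p A : continuous (gamma_fun p A).
Proof.
move=> s; apply: continuous_comp; last exact: continuous_expR.
by apply: cvgB; apply: cvgM; do ?exact: cvg_cst; [exact: cvg_id|exact: continuous_expR].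
Qed.

Lemma integrable_gamma_fun p : 0 < p -> mu.-integrable setT (EFin \o gamma_fun p 1).
Proof.
move=> p0; pose c := Num.min p 1.
have c0 : 0 < c by rewrite lt_min p0 ltr01.
have p1 : 0 < p + 1 by rewrite addr_gt0.
have lp : 0 <= (p + 1) * ln (p + 1) by apply: mulr_ge0; [exact: ltW|rewrite ln_ge0// lerDr ltW].
apply: (@integrable_le_scale _ _ (fun s => expR (- c * `|s|)) (expR ((p + 1) * ln (p + 1)))).
- exact: continuous_measurable_fun (@continuous_gamma_fun _ _).
- move=> s; rewrite ger0_norm ?expR_ge0// -expRD ler_expR mul1r.
  have [s0|s0] := leP 0 s.
    (* The tangent to exp at ln (p + 1) has slope p + 1, so p s - e^s <= -s + (p + 1) ln (p + 1):
       this is the source of the constant. *)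
    have h := expR_ge1Dx (s - ln (p + 1)).
    have h1 : (p + 1) * (1 + (s - ln (p + 1))) <= expR s.
      rewrite -[leRHS](_ : (p + 1) * expR (s - ln (p + 1)) = _); first by rewrite ler_pM2l.
      by rewrite expRD expRN lnK ?posrE// mulrCA divff ?mulr1// gt_eqF.
    have h2 : c * s <= 1 * s by apply: ler_wpM2r => //; rewrite ge_min lexx orbT.
    by rewrite ger0_norm//; move: h1 h2 p0; rewrite mulrDr mulrDr mul1r; lra.
  have h1 : c * (- s) <= p * (- s) by apply: ler_wpM2r; [rewrite oppr_ge0 ltW|rewrite ge_min lexx].
  by rewrite ltr0_norm//; have := expR_ge0 s; lra.
- exact: integrable_expRN_abs.
Qed.

Lemma gamma_int_gt0 p : 0 < p -> 0 < gamma_int p.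
Proof.
move=> p0; apply: Rintegral_gt0; first exact: integrable_gamma_fun.
by move=> s; exact: expR_gt0.
Qed.

(** The dilation r -> A r becomes the translation s -> s + ln A, which leaves the integral unchanged
    and brings out the factor A^(-p). *)
Lemma integral_gamma_fun p A : 0 < p -> 0 < A ->
  (\int[mu]_s (gamma_fun p A s)%:E = (gamma_int p * powR A (- p))%:E)%E.
Proof.
move=> p0 A0.
have E s : gamma_fun p A s = powR A (- p) * gamma_fun p 1 (s + ln A).
  rewrite /gamma_fun /powR gt_eqF// -expRD; congr expR.
  by rewrite expRD lnK ?posrE//; ring.
under eq_integral do rewrite E EFinM.
rewrite ge0_integralZl//=; last 3 first.
- apply/measurable_EFinP; apply: continuous_measurable_fun => s.
  apply: (@continuous_comp _ _ _ (shift (ln A)) (gamma_fun p 1)); last exact: continuous_gamma_fun.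
  by apply: cvgD; [exact: cvg_id|exact: cvg_cst].
- by move=> s _; rewrite lee_fin expR_ge0.
- by rewrite lee_fin powR_ge0.
rewrite integral_shift; last 2 first.
- exact: continuous_gamma_fun.
- by move=> s; exact: expR_ge0.
rewrite mulrC EFinM /gamma_int /Rintegral fineK//.
by apply: integrable_fin_num => //; exact: integrable_gamma_fun.
Qed.

End gamma_integral.

(** * Iterated integrals of products *)

Section iterated_integrals.
Variable R : realType.
Notation mu := (@lebesgue_measure R).

(** The integral of a nonnegative function is a supremum over the simple functions below it, hence
    monotone. In this form it applies to iterated integrals whose inner integrals have not been
    shown measurable. *)
Lemma nneg_le_integral (f1 f2 : R -> \bar R) :
  (forall x, (0 <= f1 x)%E) -> (forall x, (f1 x <= f2 x)%E) ->
  (\int[mu]_x f1 x <= \int[mu]_x f2 x)%E.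
Proof.
move=> f10 f12; have f20 x : (0 <= f2 x)%E := le_trans (f10 x) (f12 x).
rewrite !ge0_integralTE//; apply: ereal_sup_le => _ [h hf <-].
by exists h => // x; exact: le_trans (hf x) (f12 x).
Qed.

Lemma iter_int_ge0 (k : nat) (f : (nat -> R) -> \bar R) :
  (forall c, (0 <= f c)%E) -> (0 <= iter_int k f)%E.
Proof.
elim: k f => [|k IH] f f0 /=; first exact: f0.
by apply: integral_ge0 => s _; exact: IH.
Qed.

Lemma le_iter_int (k : nat) (f1 f2 : (nat -> R) -> \bar R) :
  (forall c, (0 <= f1 c)%E) -> (forall c, (f1 c <= f2 c)%E) ->
  (iter_int k f1 <= iter_int k f2)%E.
Proof.
elim: k f1 f2 => [|k IH] f1 f2 f0 f12 /=; first exact: f12.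
apply: nneg_le_integral => s; first exact: iter_int_ge0.
exact: IH.
Qed.

(** * Tonelli for mixtures of products of one-coordinate factors *)

Section product_integrand.
(** In [g i s r] the value of coordinate i is s, and r is the Gamma variable shared by all
    coordinates; [G i r] is the factor left once s is integrated out. *)
Variables (g : nat -> R -> R -> R) (G : nat -> R -> R).
Hypothesis mg : forall i, measurable_fun setT (fun p : R * R => g i p.1 p.2).
Hypothesis g0 : forall i s r, 0 <= g i s r.
Hypothesis gG : forall i r, (\int[mu]_s (g i s r)%:E = (G i r)%:E)%E.

Lemma factor_integral_ge0 i r : 0 <= G i r.
Proof. by rewrite -lee_fin -gG; apply: integral_ge0 => s _; rewrite lee_fin. Qed.

Lemma measurable_factor_integral i : measurable_fun setT (G i).
Proof.
apply/measurable_EFinP.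
have -> : EFin \o G i = fubini_G mu (fun p : R * R => (g i p.1 p.2)%:E).
  by apply/funext => r; rewrite /fubini_G/= gG.
apply: measurable_fun_fubini_tonelli_G; last by move=> x; rewrite lee_fin.
by apply/measurable_EFinP; exact: mg.
Qed.

Lemma measurable_factor i s : measurable_fun setT (g i s).
Proof.
exact: (measurableT_comp (mg i) (measurable_pair1 s)).
Qed.

(** The measurability half serves later, when a point is removed from the outermost integral. *)
Lemma tonelli_step i (q : R -> R) : measurable_fun setT q -> (forall r, 0 <= q r) ->
  measurable_fun setT (fun s => \int[mu]_r (q r * g i s r)%:E)%E /\
  (\int[mu]_s \int[mu]_r (q r * g i s r)%:E = \int[mu]_r (q r * G i r)%:E)%E.
Proof.
move=> mq q0; pose f (p : R * R) := (q p.2 * g i p.1 p.2)%:E.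
have mf : measurable_fun setT f.
  apply/measurable_EFinP; apply: measurable_funM => //.
  exact: measurableT_comp mq measurable_snd.
have f0 p : (0 <= f p)%E by rewrite lee_fin mulr_ge0.
split; first exact: (@measurable_fun_fubini_tonelli_F _ _ _ _ R mu f mf f0).
rewrite (@fubini_tonelli _ _ _ _ R mu mu f mf f0); apply: eq_integral => r _.
rewrite /f /=; under eq_integral do rewrite EFinM.
rewrite ge0_integralZl//=; first by rewrite gG.
- apply/measurable_EFinP; exact: (measurableT_comp (mg i) (measurable_pair2 r)).
- by move=> s _; rewrite lee_fin.
- by rewrite lee_fin.
Qed.

Lemma measurable_prod_factors k (q : R -> R) : measurable_fun setT q ->
  measurable_fun setT (fun r => q r * \prod_(i < k) G i r).
Proof.
move=> mq; apply: measurable_funM => //.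
by apply: measurable_prod => i _; exact: measurable_factor_integral.
Qed.

Lemma prod_factors_ge0 k (q : R -> R) : (forall r, 0 <= q r) ->
  forall r, 0 <= q r * \prod_(i < k) G i r.
Proof. by move=> q0 r; rewrite mulr_ge0// prodr_ge0// => i _; exact: factor_integral_ge0. Qed.

Lemma prod_last_coord k (c : nat -> R) s r :
  \prod_(i < k.+1) g i (if nat_of_ord i == k then s else c i) r =
  g k s r * \prod_(i < k) g i (c i) r.
Proof.
rewrite big_ord_recr /= eqxx mulrC; congr (_ * _).
by apply: eq_bigr => i _; rewrite ltn_eqF.
Qed.

(** Induction with [q] general: for a fixed outermost coordinate s, the factor [g k s r] is absorbed
    into [q], the inner coordinates are integrated out by induction, and [tonelli_step] then
    exchanges s and r. *)
Lemma iter_int_prod k (q : R -> R) : measurable_fun setT q -> (forall r, 0 <= q r) ->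
  iter_int k (fun c => \int[mu]_r (q r * \prod_(i < k) g i (c i) r)%:E)%E =
  (\int[mu]_r (q r * \prod_(i < k) G i r)%:E)%E.
Proof.
elim: k q => [|k IH] q mq q0.
  by rewrite /=; apply: eq_integral => r _; rewrite !big_ord0.
rewrite [LHS]/=.
have E s : iter_int k (fun c => \int[mu]_r (q r * \prod_(i < k.+1)
      g i (if nat_of_ord i == k then s else c i) r)%:E)%E =
    (\int[mu]_r ((q r * \prod_(i < k) G i r) * g k s r)%:E)%E.
  transitivity (iter_int k (fun c =>
     \int[mu]_r ((q r * g k s r) * \prod_(i < k) g i (c i) r)%:E)%E).
    congr (iter_int k _); apply/funext => c; apply: eq_integral => r _.
    by rewrite prod_last_coord mulrA.
  rewrite IH.
  - by apply: eq_integral => r _; rewrite mulrAC.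
  - by apply: measurable_funM => //; exact: measurable_factor.
  - by move=> r; rewrite mulr_ge0.
under eq_integral do rewrite E.
have [_ ->] := tonelli_step k (measurable_prod_factors k mq) (prod_factors_ge0 k q0).
by apply: eq_integral => r _; rewrite big_ord_recr /= mulrA.
Qed.

(* One coordinate hyperplane is negligible, so F may differ from the product
   integral there: at the origin the Gamma integral for |y|^(-2g) diverges,
   whereas [powR 0 _ = 0]. *)
Lemma iter_int_prod_ae k (q : R -> R) (F : (nat -> R) -> \bar R) :
  measurable_fun setT q -> (forall r, 0 <= q r) ->
  (forall c, c k != 0 ->
     F c = (\int[mu]_r (q r * \prod_(i < k.+1) g i (c i) r)%:E)%E) ->
  iter_int k.+1 F = (\int[mu]_r (q r * \prod_(i < k.+1) G i r)%:E)%E.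
Proof.
move=> mq q0 FE; rewrite -iter_int_prod//=.
pose A s := iter_int k (fun c => F (fun j => if j == k then s else c j)).
pose f (c : nat -> R) := (\int[mu]_r (q r * \prod_(i < k.+1) g i (c i) r)%:E)%E.
pose B s := iter_int k (fun c => f (fun j => if j == k then s else c j)).
have AB s : s != 0 -> A s = B s.
  move=> s0; congr (iter_int k _); apply/funext => c; apply: FE.
  by rewrite eqxx.
have mB : measurable_fun setT B.
  have -> : B = (fun s => \int[mu]_r ((q r * \prod_(i < k) G i r) * g k s r)%:E)%E.
    apply/funext => s.
    transitivity (iter_int k (fun c =>
       \int[mu]_r ((q r * g k s r) * \prod_(i < k) g i (c i) r)%:E)%E).
      congr (iter_int k _); apply/funext => c; apply: eq_integral => r _.
      by rewrite prod_last_coord mulrA.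
    rewrite iter_int_prod.
    - by apply: eq_integral => r _; rewrite mulrAC.
    - by apply: measurable_funM => //; exact: measurable_factor.
    - by move=> r; rewrite mulr_ge0.
  by have [] := tonelli_step k (measurable_prod_factors k mq) (prod_factors_ge0 k q0).
have mT : measurable ([set: R] `\ 0) by exact: measurableD.
have mBT : measurable_fun ([set: R] `\ 0) B by exact: measurable_funTS.
have AB' : {in [set: R] `\ 0, A =1 B}.
  by move=> s; rewrite inE/= => -[_ /eqP]; exact: AB.
(* The outermost integral runs over coordinate k, so the exceptional hyperplane is the single point
   s = 0; off it [A] equals [B] and inherits its measurability. *)
rewrite -/(A _) -[LHS](@integral_setD1 _ A 0)//; last first.
  by apply: eq_measurable_fun mBT => s /AB' ->.
transitivity (\int[mu]_(s in [set: R] `\ 0%R) B s)%E; first exact: eq_integral.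
exact: integral_setD1.
Qed.

End product_integrand.

(** * One-dimensional Gaussian integrals *)

Lemma integral_gauss (a m : R) : 0 < a ->
  (\int[mu]_s (expR (- a * (s - m) ^+ 2))%:E = (Num.sqrt (pi / a))%:E)%E.
Proof.
(* The integrand is an unnormalised normal density of mean m and variance 1 / (2a). *)
move=> a0; pose sg := (Num.sqrt (2 * a))^-1.
have a2 : 0 < 2 * a by rewrite mulr_gt0.
have sg0 : sg != 0 by rewrite invr_eq0 gt_eqF// sqrtr_gt0.
have sg2 : sg ^+ 2 = (2 * a)^-1 by rewrite exprVn sqr_sqrtr// ltW.
have p0 := normal_peak_gt0 sg0.
have E s : expR (- a * (s - m) ^+ 2) = (normal_peak sg)^-1 * normal_pdf m sg s.
  rewrite normal_pdfE// mulrA mulVf ?gt_eqF// mul1r /normal_fun sg2; congr expR.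
  by field; rewrite gt_eqF.
under eq_integral do rewrite E EFinM.
rewrite ge0_integralZl//=.
- rewrite integral_normal_pdf mule1 /normal_peak invrK sg2; congr (Num.sqrt _)%:E.
  by field; rewrite gt_eqF.
- by apply/measurable_EFinP; exact: measurable_normal_pdf.
- by move=> s _; rewrite lee_fin normal_pdf_ge0.
- by rewrite lee_fin invr_ge0 ltW.
Qed.

(** The share of one coordinate in the heat kernel times exp(- e^r |y|^2 / (4t)). *)
Definition gaussian1 (t x y r : R) : R :=
  (Num.sqrt (4 * pi * t))^-1 * expR (- ((x - y) ^+ 2 + expR r * y ^+ 2) / (4 * t)).

(** Completing the square: (x - y)^2 + e^r y^2 = (1 + e^r) (y - x / (1 + e^r))^2 + L(r) x^2. This is
    where the logistic function enters. *)
Lemma integral_gaussian1 (t x r : R) : 0 < t ->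
  (\int[mu]_y (gaussian1 t x y r)%:E =
   ((Num.sqrt (1 + expR r))^-1 * expR (- (x ^+ 2 / (4 * t)) * logistic r))%:E)%E.
Proof.
move=> t0; have e0 := expR1D_gt0 r.
have t4 : 0 < 4 * t by rewrite mulr_gt0.
have tp : 0 < 4 * pi * t by rewrite !mulr_gt0 ?pi_gt0.
pose a := (1 + expR r) / (4 * t).
have a0 : 0 < a by rewrite divr_gt0.
have E y : gaussian1 t x y r = ((Num.sqrt (4 * pi * t))^-1 *
    expR (- (x ^+ 2 / (4 * t)) * logistic r)) * expR (- a * (y - x / (1 + expR r)) ^+ 2).
  rewrite /gaussian1 -[RHS]mulrA -expRD; congr (_ * expR _).
  by rewrite /a /logistic; field; rewrite !gt_eqF.
under eq_integral do rewrite E EFinM.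
rewrite ge0_integralZl//=.
- rewrite integral_gauss// -EFinM mulrAC; congr (_ * _)%:E.
  rewrite -!sqrtrV ?ltW// -sqrtrM ?invr_ge0 ?ltW//; congr Num.sqrt.
  have pp := pi_gt0 R; move: (pi : R) pp {E tp} => P P0; rewrite /a.
  by field; rewrite !gt_eqF.
- apply/measurable_EFinP; apply: measurableT_comp => //.
  apply: measurable_funM => //; apply: measurable_funX; exact: measurable_funB.
Qed.

Lemma measurable_gaussian1 (t x : R) :
  measurable_fun setT (fun p : R * R => gaussian1 t x p.1 p.2).
Proof.
apply: measurable_funM => //; apply: measurableT_comp => //.
apply: measurable_funM => //; apply: measurableT_comp => //; apply: measurable_funD.
  by apply: measurable_funX; apply: measurable_funB => //; exact: measurable_fst.
apply: measurable_funM; last by apply: measurable_funX; exact: measurable_fst.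
by apply: measurableT_comp => //; exact: measurable_snd.
Qed.

End iterated_integrals.

(** * Integral representation and decay *)

Section representation.
Variable R : realType.
Notation mu := (@lebesgue_measure R).

Lemma integral_EFinZ (K : R) (f : R -> R) : mu.-integrable setT (EFin \o f) ->
  (\int[mu]_x (K * f x)%:E = (K * \int[mu]_x f x)%:E)%E.
Proof.
move=> fi; under eq_integral do rewrite EFinM.
rewrite integralZl// EFinM /Rintegral fineK//.
exact: (integrable_fin_num measurableT fi).
Qed.

Lemma enorm_sqr n (x : 'rV[R]_n) : enorm x ^+ 2 = \sum_(i < n) x ord0 i ^+ 2.
Proof. by rewrite sqr_sqrtr// sumr_ge0// => i _; exact: sqr_ge0. Qed.

Lemma powR_half_nat (a : R) n : 0 < a -> powR a (- (n%:R / 2)) = (Num.sqrt a)^-1 ^+ n.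
Proof.
move=> a0; rewrite powRN mulrC powRrM powR12_sqrt ?ltW//.
by rewrite powR_mulrn ?sqrtr_ge0// exprVn.
Qed.

Lemma powR_sqrt (a p : R) : 0 <= a -> powR (Num.sqrt a) (- (2 * p)) = powR a (- p).
Proof.
move=> a0; rewrite -powR12_sqrt// -powRrM; congr powR.
by field.
Qed.

Lemma Psi_extE n (g : R) (x : 'rV[R]_n) (t : R) : (0 < n)%N ->
  0 < g -> g < n%:R / 2 -> 0 < t ->
  Psi_ext g x t = (powR (4 * t) (- g) / gamma_int g *
    kummer g (n%:R / 2) 0 (enorm x ^+ 2 / (4 * t)))%:E.
Proof.
case: n x => // k x _ g0 gk t0; set n2 := _ / 2.
have t4 : 0 < 4 * t by rewrite mulr_gt0.
have tp : 0 < 4 * pi * t by rewrite !mulr_gt0 ?pi_gt0.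
have gg0 := gamma_int_gt0 g0.
(* The product lemmas index coordinates by [nat]; [inord] is faithful for i <= k, the only indices
   in the products. *)
pose xx (i : nat) := x ord0 (inord i).
pose K := powR (4 * t) (- g) / gamma_int g.
pose q r := K * expR (g * r).
pose G (i : nat) r := (Num.sqrt (1 + expR r))^-1 * expR (- (xx i ^+ 2 / (4 * t)) * logistic r).
have K0 : 0 < K by rewrite divr_gt0// powR_gt0.
have mq : measurable_fun setT q.
  apply: continuous_measurable_fun => r; apply: cvgM; first exact: cvg_cst.
  by apply: continuous_comp; [exact: mulrl_continuous|exact: continuous_expR].
have q0 r : 0 <= q r by rewrite mulr_ge0 ?expR_ge0 ?ltW.
have mg i : measurable_fun setT (fun p : R * R => gaussian1 t (xx i) p.1 p.2).
  exact: measurable_gaussian1.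
have gr0 i s r : 0 <= gaussian1 t (xx i) s r.
  by rewrite mulr_ge0 ?expR_ge0// invr_ge0 sqrtr_ge0.
have gG i r : (\int[mu]_s (gaussian1 t (xx i) s r)%:E = (G i r)%:E)%E.
  exact: integral_gaussian1.
rewrite /Psi_ext /Rn_int (iter_int_prod_ae mg gr0 gG mq q0); last first.
  move=> c ck; set y := \row_i c i.
  pose S := \sum_(i < k.+1) c i ^+ 2.
  (* As c k is nonzero, S = |y|^2 > 0, so the r-integral is a Gamma integral with A = S / (4t) > 0
     and returns |y|^(-2g). *)
  have S0 : 0 < S.
    rewrite /S big_ord_recr /= ltr_wpDl ?exprn_even_gt0//.
    by apply: sumr_ge0 => i _; exact: sqr_ge0.
  have yS : enorm y = Num.sqrt S.
    by congr Num.sqrt; apply: eq_bigr => i _; rewrite mxE.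
  have E r : q r * \prod_(i < k.+1) gaussian1 t (xx i) (c i) r =
      K * heat_kernel (x - y) t * gamma_fun g (S / (4 * t)) r.
    rewrite big_split /= prodr_const card_ord -expR_sum /q /heat_kernel t0 powR_half_nat//.
    rewrite /gamma_fun expRD enorm_sqr.
    have -> : \sum_(i < k.+1) - ((xx i - c i) ^+ 2 + expR r * c i ^+ 2) / (4 * t) =
       - (\sum_(i < k.+1) (x - y) ord0 i ^+ 2) / (4 * t) + - (S / (4 * t) * expR r).
      rewrite -mulr_suml sumrN big_split /= -mulr_sumr -/S.
      under eq_bigr => i _ do rewrite /xx inord_val.
      under [X in _ = - X / _ + _]eq_bigr => i _ do rewrite !mxE.
      by field; rewrite gt_eqF.
    by rewrite (expRD (- _ / _)); ring.
  under eq_integral do rewrite E EFinM.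
  rewrite ge0_integralZl//=; last 3 first.
  - apply/measurable_EFinP; apply: continuous_measurable_fun; exact: continuous_gamma_fun.
  - by move=> r _; rewrite lee_fin expR_ge0.
  - rewrite lee_fin; apply: mulr_ge0; first exact: ltW.
    by rewrite /heat_kernel t0 mulr_ge0 ?expR_ge0 ?powR_ge0.
  rewrite integral_gamma_fun ?divr_gt0// -EFinM yS powR_sqrt ?ltW//; congr EFin.
  have <- : powR (4 * t) (- g) * powR (S / (4 * t)) (- g) = powR S (- g).
    by rewrite -powRM ?ltW ?divr_gt0//; congr powR; field; rewrite gt_eqF.
  rewrite /K; move: (heat_kernel _ _) (powR (4 * t) _) (powR (S / _) _) => H a b.
  by move: (gamma_int g) gg0 => d d0; field; rewrite gt_eqF.
(* The factors (1 + e^r)^(-1/2), one for each coordinate, make up the power -n/2 in [weight], and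
   the exponents add up to |x|^2. *)
have E r : q r * \prod_(i < k.+1) G i r = K * kummer_fun g n2 0 (enorm x ^+ 2 / (4 * t)) r.
  rewrite big_split /= prodr_const card_ord -expR_sum /q /kummer_fun expr0 mul1r /weight.
  rewrite powR_half_nat ?expR1D_gt0//.
  have -> : \sum_(i < k.+1) - (xx i ^+ 2 / (4 * t)) * logistic r =
      - (enorm x ^+ 2 / (4 * t)) * logistic r.
    rewrite -mulr_suml sumrN -mulr_suml enorm_sqr; congr (- (_ / _) * _).
    by apply: eq_bigr => i _; rewrite /xx inord_val.
  by rewrite -!mulrA.
under eq_integral do rewrite E.
by rewrite integral_EFinZ//; exact: integrable_kummer_fun.
Qed.

(** * Decay estimates and the integrals in space and time *)

Lemma expRN_le_powR (g : R) : 0 < g ->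
  exists2 M, 0 < M & forall z, 0 <= z -> expR (- (z / 2)) <= M * powR (1 + z) (- g).
Proof.
(* The constant comes from 1 + ln y <= y at y = (1 + z) / (2g), multiplied by g. *)
move=> g0; exists (expR (2^-1 - g + g * ln (2 * g))) => [|z z0]; first exact: expR_gt0.
have z1 : 0 < 1 + z by rewrite ltr_wpDr.
have gg : 0 < 2 * g by rewrite mulr_gt0.
rewrite /powR gt_eqF// -expRD ler_expR.
have := expR_ge1Dx (ln ((1 + z) / (2 * g))).
rewrite lnK ?posrE ?divr_gt0// ln_div ?posrE//.
rewrite -(ler_pM2l g0) (_ : g * ((1 + z) / (2 * g)) = (1 + z) / 2); last first.
  by field; rewrite gt_eqF.
lra.
Qed.

(** Split at s = 0. For s >= 0, L >= 1/2 gives the factor exp(-z/2). For s < 0, L >= e^s / 2 and w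
    <= e^(g s) leave a Gamma integrand, whose integral is a multiple of (1 + z)^(-g). *)
Lemma kummer_le_powR (g k : R) : 0 < g -> g < k ->
  exists2 M, 0 < M & forall z, 0 <= z -> kummer g k 0 z <= M * powR (1 + z) (- g).
Proof.
move=> g0 gk; have [M M0 HM] := expRN_le_powR g0.
pose W := \int[mu]_s weight g k s.
have iw : mu.-integrable setT (EFin \o weight g k) by exact: integrable_weight.
have W0 : 0 < W by apply: Rintegral_gt0 => // s; exact: weight_gt0.
have gg0 := gamma_int_gt0 g0.
exists (expR 1 * gamma_int g * powR 2 g + W * M).
  by rewrite addr_gt0 ?mulr_gt0 ?expR_gt0 ?powR_gt0.
(* Taking 1 + z in place of z keeps the bound finite at z = 0; since e^s <= 1 for s < 0, the factor
   e pays for the change. *)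
move=> z z0; pose A := (1 + z) / 2.
have z1 : 0 < 1 + z by rewrite ltr_wpDr.
have A0 : 0 < A by rewrite divr_gt0.
have le s : kummer_fun g k 0 z s <= expR 1 * gamma_fun g A s + expR (- (z / 2)) * weight g k s.
  have s1 := logistic_gt0 s; have w0 := weight_gt0 g k s; have e0 := expR_gt0 s.
  rewrite /kummer_fun expr0 mul1r.
  have [s0|s0] := leP 0 s.
    rewrite ler_wpDl ?mulr_ge0 ?expR_ge0// mulrC ler_pM2r// ler_expR.
    have : 2^-1 <= logistic s.
      rewrite /logistic ler_pdivlMr ?expR1D_gt0//.
      have : 1 <= expR s by rewrite -expR0 ler_expR.
      by lra.
    by move/(ler_wpM2l z0); lra.
  rewrite ler_wpDr ?mulr_ge0 ?expR_ge0 ?(ltW w0)//.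
  have es : expR s <= 1 by rewrite -expR0 ler_expR ltW.
  apply: (@le_trans _ _ (expR (g * s) * expR (- z * (expR s / 2)))).
    apply: ler_pM; rewrite ?expR_ge0 ?(ltW w0)//.
      rewrite /weight ler_piMr ?expR_ge0// powRN invf_le1 ?powR_gt0 ?expR1D_gt0//.
      rewrite -[leLHS](powRr0 (1 + expR s)).
      by apply: ler_powR; rewrite ?lerDl ?ltW// (lt_trans g0).
    rewrite ler_expR !mulNr lerN2 ler_wpM2l// /logistic ler_pM2l//.
    by rewrite lef_pV2 ?posrE ?expR1D_gt0//; lra.
  by rewrite /gamma_fun -!expRD ler_expR /A; nra.
apply: (@le_trans _ _ (expR 1 * (gamma_int g * powR A (- g)) + expR (- (z / 2)) * W)).
  rewrite -lee_fin /kummer /Rintegral fineK; last first.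
    by apply: integrable_fin_num => //; exact: integrable_kummer_fun.
  apply: (@le_trans _ _ (\int[mu]_s
    (expR 1 * gamma_fun g A s + expR (- (z / 2)) * weight g k s)%:E)%E).
    apply: nneg_le_integral => s; rewrite lee_fin; first exact: ltW (kummer_fun_gt0 _ _ _ _ _).
    exact: le.
  have mgm : measurable_fun setT (gamma_fun g A).
    by apply: continuous_measurable_fun; exact: continuous_gamma_fun.
  have mw : measurable_fun setT (weight g k).
    by apply: continuous_measurable_fun; exact: continuous_weight.
  under eq_integral do rewrite EFinD.
  rewrite ge0_integralD//=; last 4 first.
  - by move=> s _; rewrite lee_fin mulr_ge0 ?expR_ge0.
  - by apply/measurable_EFinP; exact: measurable_funM.
  - by move=> s _; rewrite lee_fin mulr_ge0 ?expR_ge0// ltW ?weight_gt0.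
  - by apply/measurable_EFinP; exact: measurable_funM.
  rewrite (integral_EFinZ (expR (- (z / 2))) iw) EFinD leeD2r//.
  under eq_integral do rewrite EFinM.
  rewrite ge0_integralZl//=; last 2 first.
  - by apply/measurable_EFinP.
  - by move=> s _; rewrite lee_fin expR_ge0.
  by rewrite integral_gamma_fun.
have -> : powR A (- g) = powR 2 g * powR (1 + z) (- g).
  by rewrite /powR !gt_eqF// -expRD ln_div ?posrE//; congr expR; ring.
rewrite mulrDl; apply: lerD; first by rewrite !mulrA.
by rewrite mulrC -mulrA ler_pM2l// HM.
Qed.

(** Once the power is written as a Gamma integral, each coordinate contributes sqrt(pi / e^r). The
    exponent p thus drops by n/2, and a Gamma integral with exponent p - n/2 > 0 remains. *)
Lemma Rn_int_powR n (C p t : R) : 0 <= C -> n%:R / 2 < p -> 0 < t ->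
  Rn_int (fun x : 'rV[R]_n => (C * powR (4 * t + enorm x ^+ 2) (- p))%:E) =
  (C / gamma_int p * Num.sqrt pi ^+ n * gamma_int (p - n%:R / 2) *
    powR (4 * t) (- (p - n%:R / 2)))%:E.
Proof.
move=> C0 pn t0; have t4 : 0 < 4 * t by rewrite mulr_gt0.
have p0 : 0 < p by apply: le_lt_trans pn; rewrite divr_ge0.
have gg0 := gamma_int_gt0 p0.
have Cg : 0 <= C / gamma_int p by rewrite divr_ge0// ltW.
pose q r := C / gamma_int p * gamma_fun p (4 * t) r.
pose g (i : nat) (y r : R) := expR (- expR r * (y - 0) ^+ 2).
pose G (i : nat) (r : R) := Num.sqrt (pi / expR r).
have mq : measurable_fun setT q.
  apply: measurable_funM => //.
  by apply: continuous_measurable_fun; exact: continuous_gamma_fun.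
have q0 r : 0 <= q r by rewrite mulr_ge0 ?expR_ge0.
have mg i : measurable_fun setT (fun p : R * R => g i p.1 p.2).
  apply: measurableT_comp => //; apply: measurable_funM.
    by apply: measurableT_comp => //; apply: measurableT_comp => //; exact: measurable_snd.
  by apply: measurable_funX; apply: measurable_funB => //; exact: measurable_fst.
have g0 i s r : 0 <= g i s r by exact: expR_ge0.
have gG i r : (\int[mu]_s (g i s r)%:E = (G i r)%:E)%E.
  by rewrite integral_gauss ?expR_gt0.
transitivity (iter_int n (fun c => \int[mu]_r (q r * \prod_(i < n) g i (c i) r)%:E)%E).
  congr (iter_int n _); apply/funext => c.
  pose S := \sum_(i < n) c i ^+ 2.
  have S0 : 0 <= S by apply: sumr_ge0 => i _; exact: sqr_ge0.
  have -> : enorm (\row_(i < n) c i) ^+ 2 = S.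
    by rewrite enorm_sqr; apply: eq_bigr => i _; rewrite mxE.
  (* Because t > 0, the Gamma formula holds at every point here, the origin included. *)
  have tS : 0 < 4 * t + S by rewrite ltr_wpDr.
  have E r : q r * \prod_(i < n) g i (c i) r = C / gamma_int p * gamma_fun p (4 * t + S) r.
    rewrite /q /g -expR_sum -[LHS]mulrA -expRD; congr (_ * expR _).
    under eq_bigr do rewrite subr0.
    by rewrite -mulr_sumr -/S; ring.
  under eq_integral do rewrite E EFinM.
  rewrite ge0_integralZl//=; last 2 first.
  - by apply/measurable_EFinP; apply: continuous_measurable_fun; exact: continuous_gamma_fun.
  - by move=> r _; rewrite lee_fin expR_ge0.
  by rewrite integral_gamma_fun// -EFinM mulrA divfK// gt_eqF.
rewrite (iter_int_prod mg g0 gG _ mq q0).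
have E r : q r * \prod_(i < n) G i r =
    (C / gamma_int p * Num.sqrt pi ^+ n) * gamma_fun (p - n%:R / 2) (4 * t) r.
  rewrite prodr_const card_ord /G sqrtrM ?pi_ge0//.
  have -> : Num.sqrt (expR r)^-1 = expR (- (r / 2)).
    rewrite -[RHS]ger0_norm ?expR_ge0// -sqrtr_sqr -expRM_natl -expRN; congr (Num.sqrt (expR _)).
    by rewrite -mulr_natl; field.
  rewrite exprMn -expRM_natl /q -[LHS]mulrA -[RHS]mulrA; congr (_ * _).
  rewrite mulrCA; congr (_ * _).
  by rewrite -expRD; congr expR; rewrite -mulr_natl; field.
under eq_integral do rewrite E EFinM.
rewrite ge0_integralZl//=; last 3 first.
- by apply/measurable_EFinP; apply: continuous_measurable_fun; exact: continuous_gamma_fun.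
- by move=> r _; rewrite lee_fin expR_ge0.
- by rewrite lee_fin mulr_ge0 ?exprn_ge0 ?sqrtr_ge0// invr_ge0 ltW.
by rewrite integral_gamma_fun ?subr_gt0// -EFinM mulrA.
Qed.

(** The primitive t^(1-kp) / (1-kp) bounds the integrals over compact intervals exhausting (0, T] by
    its value at T; monotone convergence concludes. *)
Lemma integral_powRN_lty (kp T : R) : kp < 1 -> 0 < T ->
  (\int[mu]_(t in [set t : R | (0 < t < T)%R]) (powR t (- kp))%:E < +oo)%E.
Proof.
move=> k1 T0; have k0 : 0 < 1 - kp by rewrite subr_gt0.
(* With m + 2 the left endpoint stays strictly below T, even for m = 0. *)
pose F (m : nat) : set R := `[T / m.+2%:R, T]%classic.
pose f (t : R) := (powR t (- kp))%:E.
have mf D : measurable_fun D f.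
  by apply/measurable_EFinP; apply: measurable_funTS; exact: measurable_powR.
have f0 t : (0 <= f t)%E by rewrite lee_fin powR_ge0.
have ndF : {homo F : n m / (n <= m)%N >-> (n <= m)%O}.
  move=> n m nm; apply/subsetPset => t; rewrite /F /= !in_itv/= => /andP[h ->].
  rewrite andbT (le_trans _ h)// ler_pM2l// lef_pV2 ?posrE ?ltr0n//.
  by rewrite ler_nat.
have mF i : measurable (F i) by exact: measurable_itv.
have cv : (\int[mu]_(x in F i) f x)%E @[i --> \oo] -->
    (\int[mu]_(x in \bigcup_i F i) f x)%E.
  by apply: ge0_nondecreasing_set_cvg_integral => // i; exact: mf.
have bd m : (\int[mu]_(t in F m) f t <= (powR T (1 - kp) / (1 - kp))%:E)%E.
  have m0 : 0 < T / m.+2%:R by rewrite divr_gt0.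
  have d (t : R) : 0 < t -> is_derive t 1 (fun t => powR t (1 - kp) / (1 - kp)) (powR t (- kp)).
    have -> : (fun t => powR t (1 - kp) / (1 - kp)) = (1 - kp)^-1 \*: (@powR R ^~ (1 - kp)).
      by apply/funext => x; rewrite mulrC.
    move=> t0; apply: (is_derive_eq (is_deriveZ _ (is_derive1_powR (1 - kp) t0))).
    rewrite /GRing.scale/= mulrA mulVf ?gt_eqF// mul1r.
    by congr powR; ring.
  have cF (t : R) : 0 < t -> {for t, continuous (fun t => powR t (1 - kp) / (1 - kp))}.
    move=> t0; apply: differentiable_continuous; apply/derivable1_diffP.
    by case: (d t t0).
  rewrite (@continuous_FTC2 _ (fun t => powR t (- kp)) (fun t => powR t (1 - kp) / (1 - kp))).
  - by rewrite -EFinB lee_fin lerBlDr lerDl divr_ge0 ?powR_ge0// ltW.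
  - by rewrite ltr_pdivrMr// ltr_pMr// ltr1n.
  - apply: derivable_within_continuous => t; rewrite in_itv/= => /andP[h _].
    by apply: derivable_powR; rewrite in_itv/= andbT (lt_le_trans m0).
  - split.
    + move=> t; rewrite in_itv/= => /andP[h _]; have t0 := lt_trans m0 h.
      by case: (d t t0).
    + by apply: cvg_at_right_filter; exact: cF.
    + by apply: cvg_at_left_filter; exact: cF.
  - move=> t; rewrite in_itv/= => /andP[h _]; have t0 := lt_trans m0 h.
    by rewrite derive1E; case: (d t t0).
have lim_le : (\int[mu]_(t in \bigcup_i F i) f t <= (powR T (1 - kp) / (1 - kp))%:E)%E.
  rewrite -(cvg_lim _ cv)//; apply: lime_le; first by apply/cvg_ex; eexists; exact: cv.
  exact: nearW.
apply: (le_lt_trans _ (le_lt_trans lim_le (ltry _))).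
apply: ge0_subset_integral => //=.
- by rewrite -set_itvoo; exact: measurable_itv.
- by apply: bigcup_measurable => i _; exact: mF.
- exact: mf.
- by move=> t _; exact: f0.
- move=> t /= /andP[t0 tT].
  have [m hm] : exists m : nat, T / t < m%:R.
    by exists (Num.trunc (T / t)).+1; rewrite truncnS_gt.
  exists m => //; rewrite /F /= in_itv/= (ltW tT) andbT ler_pdivrMr// mulrC -ler_pdivrMr//.
  by rewrite (le_trans (ltW hm))// ler_nat -addn2 leq_addr.
Qed.

End representation.

(** * Smoothness *)

Section directional_derivatives.
Variables (R : realType) (V : normedModType R).
Implicit Types (f h : V -> R) (p v : V).

Lemma derive_affine f p v (c : R) :
  (forall e : R, f (e *: v + p) = e * c + f p) -> 'D_v f p = c.
Proof.
move=> fE; rewrite /derive; apply: cvg_lim => //.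
apply: cvg_near_cst; near=> e.
rewrite /= fE addrK /GRing.scale/= mulrA mulVf ?mul1r//.
by near: e; exact: nbhs_dnbhs_neq.
Unshelve. all: by end_near. Qed.

Lemma derive_comp_real f (h : R -> R) p v (c : R) :
  differentiable f p -> is_derive (f p) 1 h c ->
  differentiable (h \o f) p /\ 'D_v (h \o f) p = c * 'D_v f p.
Proof.
move=> df [dh hc].
have dh' : differentiable h (f p) by exact/derivable1_diffP.
have dc : differentiable (h \o f) p by exact: differentiable_comp.
split => //; rewrite !deriveE// diff_comp//= deriv1E//.
by rewrite derive1E hc mulrC.
Qed.

End directional_derivatives.

(** * An algebra of functions closed under differentiation *)

Section self_similar_algebra.
Variables (R : realType) (n : nat) (g k : R).
Hypothesis g0 : 0 < g.
Hypothesis gk : g < k.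
Notation V := ('rV[R]_n * R)%type.

(** For t > 0 the solution is a multiple of the case a = -g, j = 0; other a and j arise because
    differentiation lowers a and raises j. *)
Definition atom (a : R) (j : nat) (p : V) : R :=
  powR p.2 a * kummer g k j (enorm p.1 ^+ 2 / (4 * p.2)).

Let snd_cont : continuous (snd : V -> R).
Proof. by move=> p; exact: cvg_snd. Qed.

Let fst_cont : continuous (fst : V -> 'rV[R]_n).
Proof. by move=> p; exact: cvg_fst. Qed.

Lemma differentiable_snd (p : V) : differentiable (snd : V -> R) p.
Proof. exact: linear_differentiable. Qed.

Lemma derive_snd (p v : V) : 'D_v (snd : V -> R) p = v.2.
Proof. exact: derive_affine. Qed.

Lemma differentiable_coord1 (i : 'I_n) (p : V) :
  differentiable (fun p : V => p.1 ord0 i) p.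
Proof.
apply: (@differentiable_comp _ _ _ _ (fst : V -> 'rV[R]_n) (fun M => M ord0 i)).
  exact: linear_differentiable.
exact: differentiable_coord.
Qed.

Lemma derive_coord1 (i : 'I_n) (p v : V) :
  'D_v (fun p : V => p.1 ord0 i) p = v.1 ord0 i.
Proof. by apply: derive_affine => e; rewrite !mxE. Qed.

Lemma enorm_sqr_derive (p v : V) :
  differentiable (fun p : V => enorm p.1 ^+ 2) p /\
  'D_v (fun p : V => enorm p.1 ^+ 2) p = 2 * \sum_(i < n) p.1 ord0 i * v.1 ord0 i.
Proof.
pose h (i : 'I_n) : V -> R := (fun p : V => p.1 ord0 i) * (fun p : V => p.1 ord0 i).
have -> : (fun p : V => enorm p.1 ^+ 2) = \sum_(i < n) h i.
  by apply/funext => q; rewrite enorm_sqr fct_sumE; apply: eq_bigr => i _; rewrite expr2.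
have dh i : differentiable (h i) p by apply: differentiableM; exact: differentiable_coord1.
split; first exact: differentiable_sum.
rewrite derive_sum; last by move=> i; exact: diff_derivable.
rewrite mulr_sumr; apply: eq_bigr => i _.
have di : derivable (fun p : V => p.1 ord0 i) p v.
  exact: diff_derivable (differentiable_coord1 i p).
by rewrite deriveM// derive_coord1 /GRing.scale/=; ring.
Qed.

(** The chain rule for z = |x|^2 / (4t), with D_v z = x.v / (2t) - v_t |x|^2 / (4t^2); the powers of
    1/t are absorbed into the exponent a. *)
Definition atom_deriv a j (v p : V) : R :=
  v.2 * a * atom (a - 1) j p
  - 2^-1 * (\sum_(i < n) p.1 ord0 i * v.1 ord0 i) * atom (a - 1) j.+1 p
  + 4^-1 * v.2 * enorm p.1 ^+ 2 * atom (a - 2) j.+1 p.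

Lemma atom_derive a j (p v : V) : 0 < p.2 ->
  differentiable (atom a j) p /\ 'D_v (atom a j) p = atom_deriv a j v p.
Proof.
move=> p0; have pn : p.2 != 0 by rewrite gt_eqF.
have [dP eP] := derive_comp_real v (differentiable_snd p) (is_derive1_powR a p0).
have [dI eI] := derive_comp_real v (differentiable_snd p)
   (is_deriveV pn (is_derive_id p.2 1)).
have [dN eN] := enorm_sqr_derive p v.
pose z : V -> R := (4^-1 : R) *: ((fun p : V => enorm p.1 ^+ 2) * ((fun y : R => y^-1) \o snd)).
have zE (q : V) : z q = enorm q.1 ^+ 2 / (4 * q.2).
  by rewrite /z /GRing.scale/= /GRing.scale/= invfM mulrCA.
have dz : differentiable z p by apply: differentiableZ; exact: differentiableM.
have [dK eK] := derive_comp_real v dz (is_derive_kummer g0 gk j (z p)).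
have aE : atom a j = ((@powR R ^~ a) \o snd) * (kummer g k j \o z).
  by apply/funext => q; rewrite /atom -zE.
rewrite aE; split; first exact: differentiableM.
rewrite deriveM; [|exact: diff_derivable|exact: diff_derivable].
rewrite eP eK derive_snd /z deriveZ; last by apply: diff_derivable; exact: differentiableM.
rewrite deriveM; [|exact: diff_derivable|exact: diff_derivable].
rewrite eN eI derive_snd -/z /atom_deriv /atom -!zE /=.
have pa1 : powR p.2 (a - 1) = powR p.2 a / p.2.
  by rewrite powRB ?pn ?implybT// powRr1// ltW.
have pa2 : powR p.2 (a - 2) = powR p.2 a / p.2 ^+ 2.
  by rewrite powRB ?pn ?implybT// powR_mulrn// ltW.
rewrite pa1 pa2 /GRing.scale/= /GRing.scale/= /GRing.scale/=.
move: (kummer g k j (z p)) (kummer g k j.+1 (z p)) (powR p.2 a) (enorm p.1 ^+ 2) => K0 K1 P N.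
move: (\sum_(i < n) _) (p.2) pn => S t tn.
by field.
Qed.

(* The point of this class is that it is stable under directional derivatives. *)
Inductive heat_alg : (V -> R) -> Prop :=
| heat_alg_cst c : heat_alg (cst c)
| heat_alg_coord i : heat_alg (fun p => p.1 ord0 i)
| heat_alg_atom a j : heat_alg (atom a j)
| heat_alg_add f h : heat_alg f -> heat_alg h -> heat_alg (f + h)
| heat_alg_mul f h : heat_alg f -> heat_alg h -> heat_alg (f * h).

Lemma heat_alg_sum (I : Type) (r : seq I) (f : I -> V -> R) :
  (forall i, heat_alg (f i)) -> heat_alg (\sum_(i <- r) f i).
Proof.
move=> hf; elim/big_ind : _ => //; first exact: heat_alg_cst.
by move=> x y; exact: heat_alg_add.
Qed.

Lemma heat_alg_enorm_sqr : heat_alg (fun p => enorm p.1 ^+ 2).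
Proof.
have -> : (fun p : V => enorm p.1 ^+ 2) =
    \sum_(i < n) ((fun p : V => p.1 ord0 i) * (fun p : V => p.1 ord0 i)).
  by apply/funext => q; rewrite enorm_sqr fct_sumE; apply: eq_bigr => i _; rewrite expr2.
by apply: heat_alg_sum => i; apply: heat_alg_mul; exact: heat_alg_coord.
Qed.

Lemma heat_alg_atom_deriv a j v : heat_alg (atom_deriv a j v).
Proof.
have -> : atom_deriv a j v = cst (v.2 * a) * atom (a - 1) j
  + cst (- 2^-1) * (\sum_(i < n) (fun p : V => p.1 ord0 i) * cst (v.1 ord0 i)) * atom (a - 1) j.+1
  + cst (4^-1 * v.2) * (fun p => enorm p.1 ^+ 2) * atom (a - 2) j.+1.
  by apply/funext => q; rewrite /atom_deriv !fctE fct_sumE !mulNr.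
have asum : heat_alg (\sum_(i < n) (fun p : V => p.1 ord0 i) * cst (v.1 ord0 i)).
  by apply: heat_alg_sum => i; apply: heat_alg_mul; [exact: heat_alg_coord|exact: heat_alg_cst].
apply: heat_alg_add; first apply: heat_alg_add.
- by apply: heat_alg_mul; [exact: heat_alg_cst|exact: heat_alg_atom].
- apply: heat_alg_mul; last exact: heat_alg_atom.
  by apply: heat_alg_mul => //; exact: heat_alg_cst.
- apply: heat_alg_mul; last exact: heat_alg_atom.
  by apply: heat_alg_mul; [exact: heat_alg_cst|exact: heat_alg_enorm_sqr].
Qed.

(** Induction by the sum and product rules. The derivative is identified with a member of the
    algebra on t > 0 only, where [atom_derive] applies. *)
Lemma heat_alg_derive f : heat_alg f ->
  (forall p : V, 0 < p.2 -> differentiable f p) /\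
  (forall v, exists2 f', heat_alg f' & forall p : V, 0 < p.2 -> 'D_v f p = f' p).
Proof.
elim=> {f} [c|i|a j|f h af [df Df] ah [dh Dh]|f h af [df Df] ah [dh Dh]].
- split=> [p _|v]; first exact: differentiable_cst.
  by exists (cst 0) => [|p _]; [exact: heat_alg_cst|rewrite derive_cst].
- split=> [p _|v]; first exact: differentiable_coord1.
  by exists (cst (v.1 ord0 i)) => [|p _]; [exact: heat_alg_cst|rewrite derive_coord1].
- split=> [p p0|v]; first by have [] := atom_derive a j 0 p0.
  exists (atom_deriv a j v) => [|p p0]; first exact: heat_alg_atom_deriv.
  by have [] := atom_derive a j v p0.
- split=> [p p0|v]; first by apply: differentiableD; [exact: df|exact: dh].
  have [f' af' Ef] := Df v; have [h' ah' Eh] := Dh v.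
  exists (f' + h') => [|p p0]; first exact: heat_alg_add.
  rewrite deriveD; [|exact: diff_derivable (df p p0)|exact: diff_derivable (dh p p0)].
  by rewrite Ef// Eh.
- split=> [p p0|v]; first by apply: differentiableM; [exact: df|exact: dh].
  have [f' af' Ef] := Df v; have [h' ah' Eh] := Dh v.
  exists (f * h' + h * f') => [|p p0].
    by apply: heat_alg_add; exact: heat_alg_mul.
  rewrite deriveM; [|exact: diff_derivable (df p p0)|exact: diff_derivable (dh p p0)].
  by rewrite Ef// Eh.
Qed.

Lemma near_snd_gt0 (p : V) : 0 < p.2 -> \forall q \near p, 0 < (q : V).2.
Proof.
move=> p0; apply: (@open_nbhs_nbhs _ p [set q : V | 0 < q.2]); split => //.
apply: (@open_comp _ _ (snd : V -> R) [set x : R | 0 < x]); last exact: open_gt.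
by move=> q _; exact: snd_cont.
Qed.

Lemma near_eq_upper (u f : V -> R) (p : V) : (forall q : V, 0 < q.2 -> u q = f q) ->
  0 < p.2 -> \near p, u p = f p.
Proof. by move=> uf p0; apply: filterS (near_snd_gt0 p0) => q; exact: uf. Qed.

(* [iterD] alone would denote the lemma of ssrnat. *)
Lemma heat_alg_iterD (f u : V -> R) (vs : seq V) :
  heat_alg f -> (forall p : V, 0 < p.2 -> u p = f p) ->
  exists2 f', heat_alg f' & forall p : V, 0 < p.2 ->
    Defs.iterD vs u p = f' p.
Proof.
move=> af uf; elim: vs => [|v vs [h ah uh]]; first by exists f.
have [_ /(_ v) [h' ah' Eh]] := heat_alg_derive ah.
exists h' => // p p0 /=.
by rewrite -Eh//; apply: near_eq_derive; exact: near_eq_upper.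
Qed.

(** The half-space t > 0 is open, so near each of its points an iterated derivative of [u] coincides
    with a differentiable member of the algebra. *)
Lemma heat_alg_smooth (f u : V -> R) : heat_alg f -> (forall p : V, 0 < p.2 -> u p = f p) ->
  smooth_on [set p : V | 0 < p.2] u.
Proof.
move=> af uf vs p p0.
have [h ah uh] := heat_alg_iterD vs af uf.
have [dh _] := heat_alg_derive ah.
have nuh := near_eq_upper uh p0.
split.
  rewrite /prop_for /continuous_at uh//.
  have ch : {for p, continuous h} by apply: differentiable_continuous; exact: dh.
  apply: cvg_trans ch; apply: near_eq_cvg.
  by apply: filterS nuh => q ->.
move=> v; apply: (@near_eq_derivable _ _ _ h).
  by apply: filterS nuh => q ->.
by apply: diff_derivable; exact: dh.
Qed.

End self_similar_algebra.

(** * The solution *)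

Section self_similar_solution.
Variables (R : realType) (n : nat) (g : R).
Hypothesis n0 : (0 < n)%N.
Hypothesis g0 : 0 < g.
Hypothesis gk : g < n%:R / 2.
Notation mu := (@lebesgue_measure R).
Notation V := ('rV[R]_n * R)%type.
Notation k := (n%:R / 2).
Notation u := (Psi (n := n) g).
Notation at_ := (atom (n := n) g k).

Definition psi_cst : R := powR 4 (- g) / gamma_int g.
Notation c := psi_cst.

Lemma psi_cst_gt0 : 0 < c.
Proof. by rewrite divr_gt0 ?powR_gt0 ?gamma_int_gt0. Qed.

Lemma PsiE x t : 0 < t -> u x t = c * (powR t (- g) * kummer g k 0 (enorm x ^+ 2 / (4 * t))).
Proof. by move=> t0; rewrite /Psi Psi_extE//= /psi_cst powRM ?ltW//; ring. Qed.

Lemma uncurry_PsiE (p : V) : 0 < p.2 -> uncurry_xt u p = (cst c * at_ (- g) 0) p.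
Proof. by move=> p0; rewrite /uncurry_xt PsiE. Qed.

Lemma smooth_Psi : smooth_on [set p : V | 0 < p.2] (uncurry_xt u).
Proof.
apply: (@heat_alg_smooth _ _ g k g0 gk (cst c * at_ (- g) 0)).
  by apply: heat_alg_mul; [exact: heat_alg_cst|exact: heat_alg_atom].
exact: uncurry_PsiE.
Qed.

Lemma derive_cst_mul (b : R) (f : V -> R) (p v : V) : derivable f p v ->
  'D_v (cst b * f) p = b * 'D_v f p.
Proof.
move=> df; have [dc _] := is_derive_cst b p v; rewrite deriveM//.
by rewrite derive_cst /GRing.scale/= mulr0 addr0.
Qed.

Lemma derivable_atom a j (p v : V) : 0 < p.2 -> derivable (at_ a j) p v.
Proof.
move=> p0; apply: diff_derivable.
by have [] := @atom_derive _ _ _ _ g0 gk a j p v p0.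
Qed.

Lemma derive_atom a j (p v : V) : 0 < p.2 ->
  'D_v (at_ a j) p = atom_deriv g k a j v p.
Proof. by move=> p0; have [] := @atom_derive _ _ _ _ g0 gk a j p v p0. Qed.

Lemma sum_mul_delta (x : 'rV[R]_n) i :
  \sum_(i0 < n) x ord0 i0 * (delta_mx ord0 i : 'rV[R]_n) ord0 i0 = x ord0 i.
Proof.
rewrite (bigD1 i)//= big1 ?addr0; first by rewrite mxE !eqxx mulr1.
by move=> j ji; rewrite mxE eqxx (negbTE ji) mulr0.
Qed.

Lemma derive_atom_delta a j (p : V) i : 0 < p.2 ->
  'D_((delta_mx ord0 i : 'rV[R]_n), (0 : R)) (at_ a j) p =
  - 2^-1 * p.1 ord0 i * at_ (a - 1) j.+1 p.
Proof.
move=> p0; rewrite derive_atom// /atom_deriv /= sum_mul_delta.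
by ring.
Qed.

Lemma dt_Psi x t : 0 < t -> dt u x t =
  c * (- g * at_ (- g - 1) 0 (x, t) + 4^-1 * enorm x ^+ 2 * at_ (- g - 2) 1 (x, t)).
Proof.
move=> t0; rewrite /dt.
rewrite (near_eq_derive _ (near_eq_upper uncurry_PsiE (p := (x, t)) t0)).
rewrite derive_cst_mul; last exact: derivable_atom.
rewrite derive_atom// /atom_deriv /= big1; last by move=> i _; rewrite mxE mulr0.
by ring.
Qed.

Lemma laplacian_Psi x t : 0 < t -> laplacian u x t =
  c * (- k * at_ (- g - 1) 1 (x, t) + 4^-1 * enorm x ^+ 2 * at_ (- g - 2) 2 (x, t)).
Proof.
move=> t0; rewrite /laplacian.
have E (i : 'I_n) : 'D_((delta_mx ord0 i : 'rV[R]_n), (0 : R))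
       ('D_((delta_mx ord0 i : 'rV[R]_n), (0 : R)) (uncurry_xt u)) (x, t) =
   c * (- 2^-1 * at_ (- g - 1) 1 (x, t) + 4^-1 * x ord0 i ^+ 2 * at_ (- g - 2) 2 (x, t)).
  (* The first derivative in x_i on the whole half-space, ready to be differentiated again. *)
  pose f : V -> R := cst (- (c / 2)) * ((fun p : V => p.1 ord0 i) * at_ (- g - 1) 1).
  have fE (p : V) : 0 < p.2 ->
      'D_((delta_mx ord0 i : 'rV[R]_n), (0 : R)) (uncurry_xt u) p = f p.
    move=> p0; rewrite (near_eq_derive _ (near_eq_upper uncurry_PsiE p0)).
    rewrite derive_cst_mul; last exact: derivable_atom.
    by rewrite derive_atom_delta// /f !fctE; ring.
  rewrite (near_eq_derive _ (near_eq_upper fE (p := (x, t)) t0)).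
  have dx : derivable (fun p : V => p.1 ord0 i) (x, t) (delta_mx ord0 i, 0).
    exact: diff_derivable (differentiable_coord1 i _).
  have da : derivable (at_ (- g - 1) 1) (x, t) (delta_mx ord0 i, 0).
    exact: derivable_atom.
  rewrite derive_cst_mul; last exact: derivableM.
  rewrite deriveM// derive_atom_delta// derive_coord1 /= mxE !eqxx /GRing.scale/=.
  by rewrite (_ : - g - 1 - 1 = - g - 2); [field|ring].
under eq_bigr do rewrite E.
rewrite -mulr_sumr big_split /= sumr_const card_ord -mulr_natl.
rewrite -mulr_suml -mulr_sumr -enorm_sqr.
by field.
Qed.

Lemma heat_Psi x t : 0 < t -> dt u x t - laplacian u x t = 0.
Proof.
move=> t0; rewrite dt_Psi// laplacian_Psi// /atom /=.
have tn : t != 0 by rewrite gt_eqF.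
rewrite (_ : - g - 2 = - g - 1 - 1); last by ring.
rewrite (@powRB _ t (- g - 1) 1) ?tn ?implybT// powRr1 ?ltW//.
set z := enorm x ^+ 2 / (4 * t).
(* With |x|^2 = 4 t z every term carries t^(-g-1), and what remains is -c times the Kummer
   equation. *)
have -> : enorm x ^+ 2 = 4 * t * z by rewrite /z; field.
have := kummer_ode g0 gk z.
move: (kummer g k 0 z) (kummer g k 1 z) (kummer g k 2 z) => K0 K1 K2.
move: (powR t (- g - 1)) (z) => P z'; move: (c) (k) => c' k' ode.
transitivity (- c' * P * (g * K0 - (k' + z') * K1 + z' * K2)); last by rewrite ode mulr0.
by field.
Qed.

(** * Size, integrability and self-similarity of the solution *)

Lemma Psi_le : exists2 C, 0 < C & forall x t, 0 < t ->
  u x t <= C * powR (4 * t + enorm x ^+ 2) (- g).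
Proof.
have [M M0 HM] := kummer_le_powR g0 gk.
exists (M / gamma_int g) => [|x t t0]; first by rewrite divr_gt0 ?gamma_int_gt0.
have t4 : 0 < 4 * t by rewrite mulr_gt0.
have gg := gamma_int_gt0 g0.
rewrite /Psi Psi_extE//=.
(* This factorisation merges the prefactor (4t)^(-g) with the decay (1 + z)^(-g). *)
have -> : 4 * t + enorm x ^+ 2 = (4 * t) * (1 + enorm x ^+ 2 / (4 * t)).
  by field; rewrite gt_eqF.
have z0 : 0 <= enorm x ^+ 2 / (4 * t) by rewrite divr_ge0 ?sqr_ge0// ltW.
rewrite (@powRM _ (4 * t) (1 + _)) ?addr_ge0 ?(ltW t4)//.
have a0 : 0 < powR (4 * t) (- g) / gamma_int g by rewrite divr_gt0// powR_gt0.
apply: (@le_trans _ _ (powR (4 * t) (- g) / gamma_int g *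
    (M * powR (1 + enorm x ^+ 2 / (4 * t)) (- g)))).
  by rewrite ler_pM2l//; exact: HM.
move: (powR (4 * t) _) (powR (1 + _) _) (gamma_int g)^-1 => a b d.
by rewrite le_eqVlt; apply/orP; left; apply/eqP; ring.
Qed.

Lemma Psi_gt0 x t : 0 < t -> 0 < u x t.
Proof.
move=> t0; rewrite PsiE//.
by rewrite mulr_gt0 ?psi_cst_gt0// mulr_gt0 ?powR_gt0// kummer_gt0.
Qed.

(** By [Psi_le], u^lam is at most a multiple of (4t + |x|^2)^(-p) with p = g lam. Convergence in x
    rests on p > n/2, convergence at t = 0 on p - n/2 < 1. *)
Lemma Psi_powR_integral (lam T : R) : 0 < lam -> k < g * lam -> g * lam - k < 1 -> 0 < T ->
  (\int[mu]_(t in [set t : R | (0 < t < T)%R])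
     Rn_int (fun x => (powR `|u x t| lam)%:E) < +oo)%E.
Proof.
move=> l0 kp p1 T0; have [C C0 HC] := Psi_le.
set p := g * lam in kp p1; set kap := p - k in p1.
have p0 : 0 < p by rewrite mulr_gt0.
have kap0 : 0 < kap by rewrite subr_gt0.
pose D := powR C lam.
have D0 : 0 <= D by exact: powR_ge0.
pose B := D / gamma_int p * Num.sqrt pi ^+ n * gamma_int kap * powR 4 (- kap).
have B0 : 0 <= B.
  rewrite !mulr_ge0 ?powR_ge0 ?exprn_ge0 ?sqrtr_ge0 ?invr_ge0//.
  - by rewrite ltW ?gamma_int_gt0.
  - by rewrite ltW ?gamma_int_gt0.
have bd (t : R) : 0 < t ->
    (Rn_int (fun x => (powR `|u x t| lam)%:E) <= (B * powR t (- kap))%:E)%E.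
  move=> t0.
  apply: (@le_trans _ _ (Rn_int (fun x : 'rV[R]_n =>
     (D * powR (4 * t + enorm x ^+ 2) (- p))%:E))).
    apply: le_iter_int => cc; rewrite lee_fin ?powR_ge0//.
    set x := \row_i cc i; rewrite gtr0_norm ?Psi_gt0//.
    have ux := HC x t t0.
    have u0 := ltW (Psi_gt0 x t0).
    apply: (@le_trans _ _ (powR (C * powR (4 * t + enorm x ^+ 2) (- g)) lam)).
      apply: ge0_ler_powR; rewrite ?nnegrE//; first exact: ltW.
      exact: le_trans u0 ux.
    by rewrite powRM ?powR_ge0 ?(ltW C0)// -powRrM mulNr.
  rewrite Rn_int_powR// lee_fin powRM ?(ltW t0)// /B -/kap.
  by rewrite mulrA.
apply: (@le_lt_trans _ _ (\int[mu]_(t in [set t : R | (0 < t < T)%R]) (B * powR t (- kap))%:E)%E).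
  rewrite integral_mkcond [leRHS]integral_mkcond; apply: nneg_le_integral => t; rewrite !patchE.
    by case: ifPn => // _; apply: iter_int_ge0 => cc; rewrite lee_fin powR_ge0.
  by case: ifPn => //; rewrite inE/= => /andP[t0 _]; exact: bd.
under eq_integral do rewrite EFinM.
rewrite ge0_integralZl//=.
- by apply: lte_mul_pinfty => //; exact: integral_powRN_lty.
- by rewrite -set_itvoo; exact: measurable_itv.
- by apply/measurable_EFinP; apply: measurable_funTS; exact: measurable_powR.
- by move=> t _; rewrite lee_fin powR_ge0.
Qed.

Lemma powR_mulNK (t a b : R) : 0 < t -> powR t a * (powR t (- a) * b) = b.
Proof. by move=> t0; rewrite mulrA powRN divff ?mul1r// gt_eqF// powR_gt0. Qed.

Lemma Psi_origin t : 0 < t -> powR t g * u 0 t = u 0 1.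
Proof.
move=> t0; rewrite !PsiE// powR1 mul1r.
have -> : enorm (0 : 'rV[R]_n) = 0.
  by rewrite /enorm big1 ?sqrtr0// => i _; rewrite mxE expr0n.
by rewrite expr0n /= !mul0r mulrCA powR_mulNK.
Qed.

Lemma Psi_parabolic_bounds : exists c1 c2 : R, 0 < c1 /\ 0 < c2 /\
  forall x t, 0 < t -> enorm x < Num.sqrt t -> c1 <= powR t g * u x t <= c2.
Proof.
have c0 := psi_cst_gt0.
(* For |x| < sqrt t the argument |x|^2 / (4t) lies between 0 and 1/4, and M_0 is nonincreasing. *)
exists (c * kummer g k 0 4^-1), (c * kummer g k 0 0).
split; first by rewrite mulr_gt0// kummer_gt0.
split; first by rewrite mulr_gt0// kummer_gt0.
move=> x t t0 xt; rewrite PsiE//.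
have -> : powR t g * (c * (powR t (- g) * kummer g k 0 (enorm x ^+ 2 / (4 * t)))) =
    c * kummer g k 0 (enorm x ^+ 2 / (4 * t)).
  by rewrite mulrCA powR_mulNK.
have t4 : 0 < 4 * t by rewrite mulr_gt0.
rewrite !ler_pM2l//; apply/andP; split; apply: kummer_nonincreasing => //.
  rewrite ler_pdivrMr// mulrA mulVf// mul1r -[leRHS]sqr_sqrtr ?(ltW t0)//.
  by rewrite ler_sqr ?nnegrE ?sqrtr_ge0// ltW.
by rewrite divr_ge0 ?sqr_ge0// ltW.
Qed.

End self_similar_solution.

Theorem theorem5p2 (R : realType) (n : nat) (lam eps gamma : R) :
  (1 <= n)%N ->
  (n%:R + 2) / n%:R <= lam ->
  0 < eps < 1 ->
  gamma = (n%:R + 2 - eps) / (2 * lam) ->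
  let u := Psi (n := n) gamma in
  (* Psi is finite and positive *)
  (forall x t, 0 < t -> (Psi_ext gamma x t < +oo)%E /\ 0 < u x t) /\
  (* C^infinity on R^n x (0,oo) *)
  smooth_on [set p : 'rV[R]_n * R | 0 < p.2] (uncurry_xt u) /\
  (* solves the heat equation *)
  (forall x t, 0 < t -> dt u x t - laplacian u x t = 0) /\
  (* u in L^lam(R^n x (0,T)) for every T > 0 *)
  (forall T : R, 0 < T ->
     (\int[@lebesgue_measure R]_(t in [set t : R | (0 < t < T)%R])
         Rn_int (fun x => (powR `|u x t| lam)%:E) < +oo)%E) /\
  (* self-similarity at x = 0 *)
  (forall t, 0 < t -> powR t gamma * u 0 t = u 0 1) /\
  (* two-sided bound on the parabolic region |x| < sqrt t *)
  (exists c1 c2 : R, 0 < c1 /\ 0 < c2 /\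
     forall x t, 0 < t -> enorm x < Num.sqrt t ->
       c1 <= powR t gamma * u x t <= c2).
Proof.
move=> n0 lamn /andP[e0 e1] gE u.
have nn : 0 < n%:R :> R by rewrite ltr0n.
have l0 : 0 < lam by apply: lt_le_trans lamn; rewrite divr_gt0// addr_gt0.
have nl : n%:R + 2 <= lam * n%:R by rewrite -ler_pdivrMr.
have g0 : 0 < gamma by rewrite gE divr_gt0 ?mulr_gt0//; lra.
have gl : gamma * lam = (n%:R + 2 - eps) / 2 by rewrite gE; field; rewrite gt_eqF.
(* Indeed gamma lam = (n + 2 - eps) / 2 < (n + 2) / 2 <= lam n / 2. *)
have gk : gamma < n%:R / 2.
  by rewrite -(ltr_pM2r l0) gl; nra.
split; first by move=> x t t0; rewrite Psi_extE// ltry; split => //; exact: Psi_gt0.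
split; first exact: smooth_Psi.
split; first by move=> x t t0; exact: heat_Psi.
(* Both exponent conditions hold since gamma lam - n/2 = 1 - eps/2 lies strictly between 0 and 1. *)
split; first by move=> T T0; apply: Psi_powR_integral => //; rewrite gl; lra.
split; first by move=> t t0; exact: Psi_origin.
exact: Psi_parabolic_bounds.
Qed.
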